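(* One has $\lim_{\mu\downarrow0}x(\mu)=\overline{x}\in\operatorname{ri}\mathbf{X}_\lambda$.
   Context: Let $n,p,q$ be positive integers, $y\in\mathbb{R}^q$, $\lambda>0$, $\Phi:\mathbb{R}^n\to\mathbb{R}^q$ linear, and $D:\mathbb{R}^p\to\mathbb{R}^n$ linear with adjoint $D^*$. Standing assumption: $\operatorname{Ker} D^*\cap\operatorname{Ker}\Phi=\{0\}$. Let $\mathbf{X}_\lambda=\operatorname*{argmin}_{x\in\mathbb{R}^n}\frac12\|y-\Phi x\|_2^2+\lambda\|D^*x\|_1$, and let $\operatorname{ri}$ denote relative interior. Set $Q=\Phi^*\Phi$, $c=\Phi^*y$, $\tilde I=(I_p\ \ {-I_p})$ (a $p\times 2p$ matrix), $e=(1,\dots,1)\in\mathbb{R}^{2p}$. Primal problem $(P)$: minimize $f(x,z)$ over $x\in\mathbb{R}^n$, $z\in[0,+\infty)^{2p}$, where $f(x,z)=\frac12\langle Qx,x\rangle-\langle c,x\rangle+\lambda\langle e,z\rangle$ if $D^*x+\tilde I z=0$ and $f(x,z)=+\infty$ otherwise. Dual problem $(D)$: maximize $g(x,s,u)$ over $x\in\mathbb{R}^n$, $s\in[0,+\infty)^{2p}$, $u\in\mathbb{R}^p$, where $g(x,s,u)=-\frac12\langle Qx,x\rangle$ if $Du+c-Qx=0$ and $s=\lambda e-\tilde I^*u$, and $g=-\infty$ otherwise. $S_{(P)}$ and $S_{(D)}$ denote the (nonempty) sets of optimal solutions $(x,z)$ of $(P)$ and $(x,s,u)$ of $(D)$;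 $\alpha$ is the common optimal value. For $\mu>0$, let $F_\mu(x,z)=f(x,z)+\mu\,\xi(z/\mu)$, where $\xi(z)=-\ln\big(\prod_{i=1}^{2p}z_i\big)^{1/(2p)}$ if all $z_i>0$ and $\xi(z)=+\infty$ otherwise. $F_\mu$ has a unique minimizer over $\mathbb{R}^n\times\mathbb{R}^{2p}$, denoted $(x(\mu),z(\mu))$. Let $\overline I=\{i:\ z_i>0\text{ for some }(x,z)\in S_{(P)}\}$ and $\overline J=\{i:\ s_i>0\text{ for some }(x,s,u)\in S_{(D)}\}$. Let $\varphi_{\overline I}(w)=\big(\prod_{i\in\overline I}w_i\big)^{1/\operatorname{card}(\overline I)}$ if $w_i>0$ for all $i\in\overline I$, and $-\infty$ otherwise (constant $1$ if $\overline I=\emptyset$). Then $(\overline x,\overline z)$ (the analytic center of $(P)$) is the unique maximizer of $\varphi_{\overline I}(z_{\overline I})$ over all $(x,z)\in\mathbb{R}^n\times[0,+\infty)^{2p}$ satisfying $\frac12\langle Qx,x\rangle-\langle c,x\rangle+\lambda\langle e,z\rangle=\alpha$, $D^*x+\tilde I z=0$ and $z_{\overline J}=0$. *)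

(* Defs.v *)
From HB Require Import structures.
From mathcomp Require Import all_boot all_order all_algebra.
From mathcomp Require Import all_classical all_reals all_analysis.

Set Implicit Arguments.
Unset Strict Implicit.
Unset Printing Implicit Defensive.

Import Order.TTheory GRing.Theory Num.Theory.
Import numFieldNormedType.Exports.

Local Open Scope classical_set_scope.
Local Open Scope ring_scope.

Section Optimization.
Context {T : Type} {d : Order.disp_t} {Y : porderType d}.

Definition argmin (A : set T) (h : T -> Y) : set T :=
  [set a | A a /\ forall b, A b -> (h a <= h b)%O].

Definition argmax (A : set T) (h : T -> Y) : set T :=
  [set a | A a /\ forall b, A b -> (h b <= h a)%O].

End Optimization.

Section Vectors.
Context {R : realType} {m : nat}.
Implicit Types (u v : 'cV[R]_m) (C : set 'cV[R]_m).

Definition dotv u v : R := \sum_i u i ord0 * v i ord0.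

Definition norm2 u : R := Num.sqrt (\sum_i u i ord0 ^+ 2).

Definition norm1 u : R := \sum_i `|u i ord0|.

Definition affine_hull C : set 'cV[R]_m :=
  [set x | exists (k : nat) (a : 'I_k -> R) (v : 'I_k -> 'cV[R]_m),
    [/\ forall i, C (v i), \sum_i a i = 1 & x = \sum_i a i *: v i]].

Definition relint C : set 'cV[R]_m :=
  [set x | C x /\ \forall w \near x, affine_hull C w -> C w].

Definition nneg_vec : set 'cV[R]_m := [set z | forall i, 0 <= z i ord0].

End Vectors.

(* For I = set0 this is 1, because 0^-1 = 0 and a `^ 0 = 1. *)
Definition geomean {R : realType} {m : nat} (I : {set 'I_m}) (z : 'cV[R]_m)
    : \bar R :=
  if [forall i in I, 0 < z i ord0]
  then ((\prod_(i in I) z i ord0) `^ (#|I|%:R^-1))%:E else -oo%E.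

(* Vectors of R^(2p) are indexed by 'I_(p + p). *)
Section Lasso.
Context {R : realType} {n p q : nat}.
Variables (Phi : 'M[R]_(q, n)) (y : 'cV[R]_q) (D : 'M[R]_(n, p)) (lambda : R).
Implicit Types (x : 'cV[R]_n) (z s : 'cV[R]_(p + p)) (u : 'cV[R]_p).

Definition lasso_objective x : R :=
  2^-1 * norm2 (y - Phi *m x) ^+ 2 + lambda * norm1 (D^T *m x).

Definition lasso_solutions : set 'cV[R]_n := argmin setT lasso_objective.

Definition Qmx : 'M[R]_n := Phi^T *m Phi.

Definition cvec : 'cV[R]_n := Phi^T *m y.

Definition Itilde : 'M[R]_(p, p + p) := row_mx 1%:M (- 1%:M).

Definition evec : 'cV[R]_(p + p) := const_mx 1.

Definition quad_objective x z : R :=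
  2^-1 * dotv (Qmx *m x) x - dotv cvec x + lambda * dotv evec z.

Definition primal_objective (w : 'cV[R]_n * 'cV[R]_(p + p)) : \bar R :=
  let: (x, z) := w in
  if D^T *m x + Itilde *m z == 0 then (quad_objective x z)%:E else +oo%E.

Definition primal_domain : set ('cV[R]_n * 'cV[R]_(p + p)) :=
  [set w | nneg_vec w.2].

Definition primal_solutions : set ('cV[R]_n * 'cV[R]_(p + p)) :=
  argmin primal_domain primal_objective.

Definition dual_objective (w : 'cV[R]_n * 'cV[R]_(p + p) * 'cV[R]_p)
    : \bar R :=
  let: (x, s, u) := w in
  if (D *m u + cvec - Qmx *m x == 0) && (s == lambda *: evec - Itilde^T *m u)
  then (- (2^-1 * dotv (Qmx *m x) x))%:E else -oo%E.

Definition dual_domain : set ('cV[R]_n * 'cV[R]_(p + p) * 'cV[R]_p) :=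
  [set w | nneg_vec w.1.2].

Definition dual_solutions : set ('cV[R]_n * 'cV[R]_(p + p) * 'cV[R]_p) :=
  argmax dual_domain dual_objective.

(* The optimal value of the primal problem; by strong duality it is also the  *)
(* optimal value of the dual problem.                                         *)
Definition optimal_value : \bar R :=
  ereal_inf (primal_objective @` primal_domain).

Definition barrier z : \bar R :=
  if [forall i, 0 < z i ord0]
  then (- ln ((\prod_i z i ord0) `^ ((2 * p)%:R^-1)))%:E else +oo%E.

Definition penalized_objective (mu : R) (w : 'cV[R]_n * 'cV[R]_(p + p))
    : \bar R :=
  (primal_objective w + mu%:E * barrier (mu^-1 *: w.2))%E.

(* The minimizer is unique for mu > 0, so that `get` selects it. *)
Definition central_path (mu : R) : 'cV[R]_n * 'cV[R]_(p + p) :=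
  get (argmin setT (penalized_objective mu)).

Definition Ibar : {set 'I_(p + p)} :=
  [set i | `[< exists w, primal_solutions w /\ 0 < w.2 i ord0 >]]%SET.

Definition Jbar : {set 'I_(p + p)} :=
  [set i | `[< exists w, dual_solutions w /\ 0 < w.1.2 i ord0 >]]%SET.

Definition analytic_center_domain : set ('cV[R]_n * 'cV[R]_(p + p)) :=
  [set w | [/\ nneg_vec w.2,
              (quad_objective w.1 w.2)%:E = optimal_value,
              D^T *m w.1 + Itilde *m w.2 = 0 &
              forall i, i \in Jbar -> w.2 i ord0 = 0]].

(* The maximizer is unique, so that `get` selects it. *)
Definition analytic_center : 'cV[R]_n * 'cV[R]_(p + p) :=
  get (argmax analytic_center_domain (fun w => geomean Ibar w.2)).

End Lasso.

(* Main.v *)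
Require Import Defs.
From HB Require Import structures.
From mathcomp Require Import all_boot all_order all_algebra.
From mathcomp Require Import all_classical all_reals all_analysis.
From mathcomp Require Import ring lra.

Set Implicit Arguments.
Unset Strict Implicit.
Unset Printing Implicit Defensive.

Import Order.TTheory GRing.Theory Num.Theory.
Import numFieldNormedType.Exports.

Local Open Scope classical_set_scope.
Local Open Scope ring_scope.

(** Write [f] for the objective of (P), [w = (x, z)], and let [w_mu] be the
    minimizer of [F_mu].  Everything follows from the stationarity of [F_mu]
    at [w_mu]: along every direction [d] in the kernel of the linear constraint,
<<
      f'(w_mu) d = kappa * sum_i d_i / z_mu_i,    kappa = mu / (2 p).
>>
    It is used with three kinds of directions.

    - [d = w - w_mu] with [w] feasible.  Expanding the quadratic [f] around
      [w_mu] gives [f w_mu + kappa * sum_i z_i / z_mu_i - mu <= f w]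
      ([central_path_gap]).  So [w_mu] is optimal up to [mu]; by coercivity,
      which rests on the kernel condition, the path stays bounded as
      [mu] tends to 0, and its cluster points are optimal
      ([cluster_solution]).  If [w] is itself optimal then also
      [z_i <= 2 p * z_mu_i], so a cluster point is positive on all of [Ibar]
      ([cluster_gt0]).

    - [d = w' - w] with [w] and [w'] both optimal.  Then [Phi] kills the
      [x]-part of [d] and [f] has slope 0 along [d] at every point
      ([quad_slope_solution]), whence [sum_i (z'_i - z_i) / z_mu_i = 0] for all
      [mu].  Only indices in [Ibar] contribute, and letting [mu] tend to 0
      along a cluster point [w~] gives [sum_(i in Ibar) z'_i / z~_i = #|Ibar|].
      The inequality between arithmetic and geometric means now says that [w~]
      maximizes the geometric mean over the optimal set, and its equality case
      that no other point does ([cluster_center]).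

    - Directions that isolate the coordinates.  They show that
      [s_i = kappa / z_mu_i] is part of a dual feasible point whose duality gap
      is exactly [mu] ([central_dual_gap]).  The dual value is therefore at
      least the primal one, dual and primal solutions are complementary, and
      the condition [z_i = 0] on [Jbar] holds at every primal solution
      ([analytic_center_domainE]): the analytic center is taken over the whole
      primal solution set.

    Hence the analytic center is the only cluster point of a path that remains
    in a compact set, and is its limit.

    For the relative interior, at the center [z] is positive on [Ibar], and of
    two paired coordinates at most one lies in [Ibar]; so the signs of the
    entries of [D^T x] on [Ibar] persist near the center.  An affine
    combination of solutions stays on the affine hull of the optimal face,
    where [f] is constant and [z] vanishes off [Ibar]; near the center those
    signs make its remaining [z]-coordinates nonnegative, so it is optimal
    again ([analytic_center_relint]). *)

(** * The Euclidean inner product *)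

Section DotProduct.
Context {R : realType}.

Lemma dotvE m (u v : 'cV[R]_m) : dotv u v = (u^T *m v) ord0 ord0.
Proof. by rewrite mxE; apply: eq_bigr => i _; rewrite mxE. Qed.

Lemma dotvC m (u v : 'cV[R]_m) : dotv u v = dotv v u.
Proof. by apply: eq_bigr => i _; rewrite mulrC. Qed.

Lemma dotvDr m (u v w : 'cV[R]_m) : dotv u (v + w) = dotv u v + dotv u w.
Proof. by rewrite !dotvE mulmxDr mxE. Qed.

Lemma dotvDl m (u v w : 'cV[R]_m) : dotv (u + v) w = dotv u w + dotv v w.
Proof. by rewrite dotvC dotvDr !(dotvC w). Qed.

Lemma dotvZr m a (u v : 'cV[R]_m) : dotv u (a *: v) = a * dotv u v.
Proof. by rewrite !dotvE -scalemxAr mxE. Qed.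

Lemma dotvZl m a (u v : 'cV[R]_m) : dotv (a *: u) v = a * dotv u v.
Proof. by rewrite dotvC dotvZr dotvC. Qed.

Lemma dotvNr m (u v : 'cV[R]_m) : dotv u (- v) = - dotv u v.
Proof. by rewrite -scaleN1r dotvZr mulN1r. Qed.

Lemma dotvNl m (u v : 'cV[R]_m) : dotv (- u) v = - dotv u v.
Proof. by rewrite dotvC dotvNr dotvC. Qed.

Lemma dotv0 m (u : 'cV[R]_m) : dotv u 0 = 0.
Proof. by rewrite -(scale0r (0 : 'cV[R]_m)) dotvZr mul0r. Qed.

Lemma dotv_mulmx m k (A : 'M[R]_(m, k)) u v :
  dotv (A *m u) v = dotv u (A^T *m v).
Proof. by rewrite !dotvE trmx_mul mulmxA. Qed.

Lemma dotv_ge0 m (u : 'cV[R]_m) : 0 <= dotv u u.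
Proof. by apply: sumr_ge0 => i _; rewrite -expr2 sqr_ge0. Qed.

Lemma dotv_le0 m (u : 'cV[R]_m) : dotv u u <= 0 -> u = 0.
Proof.
move=> u0; have /eqP : dotv u u = 0 by apply/le_anti; rewrite u0 dotv_ge0.
rewrite psumr_eq0 => [/allP u2|i _]; last by rewrite -expr2 sqr_ge0.
apply/colP => i; rewrite mxE; have := u2 i (mem_index_enum i).
by rewrite /= mulf_eq0 orbb => /eqP.
Qed.

Lemma dotv_coord m (u : 'cV[R]_m) i : u i ord0 ^+ 2 <= dotv u u.
Proof.
rewrite /dotv (bigD1 i) //= -expr2 lerDl.
by apply: sumr_ge0 => j _; rewrite -expr2 sqr_ge0.
Qed.

Lemma norm2_sqr m (u : 'cV[R]_m) : norm2 u ^+ 2 = dotv u u.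
Proof.
rewrite /norm2 sqr_sqrtr; last by apply: sumr_ge0 => i _; rewrite sqr_ge0.
by apply: eq_bigr => i _; rewrite expr2.
Qed.

End DotProduct.

(** * The primal problem *)

Section PrimalProblem.
Context {R : realType} {n p q : nat}.
Variables (Phi : 'M[R]_(q, n)) (y : 'cV[R]_q) (D : 'M[R]_(n, p)) (lambda : R).
Implicit Types (w d : 'cV[R]_n * 'cV[R]_(p + p)) (z : 'cV[R]_(p + p)).

Definition quad_value w : R := quad_objective Phi y lambda w.1 w.2.

Definition constr w : 'cV[R]_p := D^T *m w.1 + Itilde *m w.2.

Definition feasible w : Prop := nneg_vec w.2 /\ constr w = 0.

(** The directional derivative of [quad_value] at [w] along [d]. *)
Definition quad_slope w d : R :=
  dotv (Qmx Phi *m w.1 - cvec Phi y) d.1 + lambda * dotv (evec (R := R)) d.2.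

Lemma constr_is_linear : linear constr.
Proof.
move=> a w d; rewrite /constr /= !mulmxDr -!scalemxAr scalerDr.
by rewrite addrACA.
Qed.

HB.instance Definition _ :=
  GRing.isLinear.Build R ('cV[R]_n * 'cV[R]_(p + p))%type 'cV[R]_p _ constr
    constr_is_linear.

Lemma Itilde_mul z i : (Itilde *m z) i ord0 =
  z (lshift p i) ord0 - z (rshift p i) ord0.
Proof.
by rewrite -{1}[z]vsubmxK /Itilde mul_row_col mul1mx mulNmx mul1mx !mxE.
Qed.

Lemma constr_coord w i : constr w = 0 ->
  (D^T *m w.1) i ord0 = w.2 (rshift p i) ord0 - w.2 (lshift p i) ord0.
Proof.
move=> /colP/(_ i); rewrite mxE Itilde_mul [RHS]mxE => /eqP.
by rewrite addr_eq0 opprB => /eqP.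
Qed.

Lemma dotv_evec z : dotv (evec (R := R)) z = \sum_i z i ord0.
Proof. by apply: eq_bigr => i _; rewrite mxE mul1r. Qed.

Lemma dotv_Qmx x x' :
  dotv (Qmx Phi *m x) x' = dotv (Phi *m x) (Phi *m x').
Proof. by rewrite /Qmx -mulmxA dotv_mulmx trmxK. Qed.

Lemma quad_along w d t : quad_value (w + t *: d) =
  quad_value w + t * quad_slope w d +
    t ^+ 2 * (2^-1 * dotv (Phi *m d.1) (Phi *m d.1)).
Proof.
rewrite /quad_value /quad_objective /quad_slope /= !dotv_Qmx.
rewrite !mulmxDr -!scalemxAr.
rewrite !(dotvDl, dotvDr, dotvZl, dotvZr, dotvNl) dotv_Qmx.
rewrite (dotvC (Phi *m d.1) (Phi *m w.1)).
by field.
Qed.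

Lemma quad_expansion w w' :
  quad_value w' = quad_value w + quad_slope w (w' - w) +
    2^-1 * dotv (Phi *m (w'.1 - w.1)) (Phi *m (w'.1 - w.1)).
Proof.
have := quad_along w (w' - w) 1.
by rewrite scale1r addrC subrK => ->; rewrite mul1r expr1n mul1r.
Qed.

Lemma quad_slope_lin w d1 d2 a :
  quad_slope w (a *: d1 + d2) = a * quad_slope w d1 + quad_slope w d2.
Proof. by rewrite /quad_slope /= !(dotvDr, dotvZr); ring. Qed.

(** Completing the square with [y]: an upper bound on the objective now controls
    the residual and, where [z >= 0], the sum of the [z_i]. *)
Lemma quad_residual w : quad_value w =
  2^-1 * dotv (y - Phi *m w.1) (y - Phi *m w.1) - 2^-1 * dotv y y
  + lambda * \sum_i w.2 i ord0.
Proof.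
rewrite /quad_value /quad_objective dotv_evec dotv_Qmx.
rewrite /cvec (dotv_mulmx Phi^T) trmxK.
rewrite !(dotvDl, dotvDr, dotvNl, dotvNr) (dotvC (Phi *m w.1) y).
by field.
Qed.

Lemma primal_objective_fin w : constr w = 0 ->
  primal_objective Phi y D lambda w = (quad_value w)%:E.
Proof. by case: w => x z; rewrite /constr /= => ->; rewrite eqxx. Qed.

Lemma primal_objective_pinfty w : constr w <> 0 ->
  primal_objective Phi y D lambda w = +oo%E.
Proof. by case: w => x z; rewrite /constr /= => /eqP/negPf ->. Qed.

Lemma primal_solutionsP w : primal_solutions Phi y D lambda w <->
  feasible w /\ forall w', feasible w' -> quad_value w <= quad_value w'.
Proof.
have z0 : feasible 0 by split; [move=> i; rewrite mxE | rewrite linear0].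
split=> [[w0 wmin]|[[w0 cw] wmin]].
  have cw : constr w = 0.
    apply: contrapT => cw; have := wmin 0 z0.1.
    by rewrite (primal_objective_pinfty cw) (primal_objective_fin z0.2).
  split=> // w' [w'0 cw']; have := wmin w' w'0.
  by rewrite !primal_objective_fin // lee_fin.
split=> // w' w'0; rewrite (primal_objective_fin cw).
have [cw'|cw'] := pselect (constr w' = 0).
  by rewrite primal_objective_fin // lee_fin; exact: wmin.
by rewrite primal_objective_pinfty // leey.
Qed.

Lemma optimal_valueP w : primal_solutions Phi y D lambda w ->
  optimal_value Phi y D lambda = (quad_value w)%:E.
Proof.
move=> sw; have [[w0 cw] _] := (primal_solutionsP w).1 sw.
apply/le_anti/andP; split.
  by apply: ereal_inf_lbound; exists w => //; rewrite primal_objective_fin.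
apply: le_ereal_inf_tmp => _ [w' w'0 <-].
by rewrite -primal_objective_fin //; exact: sw.2.
Qed.

End PrimalProblem.

(** * Primal solutions and lasso solutions *)

Section PrimalSolutions.
Context {R : realType} {n p q : nat}.
Variables (Phi : 'M[R]_(q, n)) (y : 'cV[R]_q) (D : 'M[R]_(n, p)) (lambda : R).
Hypothesis lambda_gt0 : 0 < lambda.
Implicit Types (w d : 'cV[R]_n * 'cV[R]_(p + p)) (z : 'cV[R]_(p + p)).

Local Notation quad := (quad_value Phi y lambda).
Local Notation slope := (quad_slope Phi y lambda).
Local Notation solution := (primal_solutions Phi y D lambda).

Lemma feasible_segment w w' t : 0 <= t <= 1 -> feasible D w -> feasible D w' ->
  feasible D (w + t *: (w' - w)).
Proof.
move=> /andP[t0 t1] [w0 cw] [w'0 cw']; split.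
  move=> i; have := w0 i; have := w'0 i; rewrite /= !mxE.
  by move=> a b; nra.
by rewrite linearD linearZ linearB /= cw cw' subrr scaler0 addr0.
Qed.

(** Strict convexity in [Phi x]: at the midpoint of two solutions with different
    [Phi x] the objective would drop below the optimal value. *)
Lemma solution_Phi w w' : solution w -> solution w' ->
  Phi *m (w'.1 - w.1) = 0.
Proof.
move=> /primal_solutionsP[fw wmin] /primal_solutionsP[fw' w'min].
apply: dotv_le0.
have half : 0 <= (2^-1 : R) <= 1 by lra.
have := wmin _ (feasible_segment half fw fw'); rewrite quad_along /=.
have := w'min _ fw; rewrite (quad_expansion _ _ _ w w').
by set N := dotv _ _; lra.
Qed.

Lemma solution_quad w w' : solution w -> solution w' -> quad w = quad w'.
Proof.
move=> /primal_solutionsP[fw wmin] /primal_solutionsP[fw' w'min].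
by apply/le_anti; rewrite wmin // w'min.
Qed.

(** [Phi] kills [w'.1 - w.1], so the slope along [w' - w] does not depend on the
    base point [v]; at [v = w] it is the difference of two optimal values. *)
Lemma quad_slope_solution v w w' : solution w -> solution w' ->
  slope v (w' - w) = 0.
Proof.
move=> sw sw'; have Pd := solution_Phi sw sw'.
have := quad_expansion Phi y lambda w w'.
rewrite (solution_quad sw sw') Pd dotv0 mulr0 addr0 /quad_slope /=.
rewrite !dotvDl !dotv_Qmx ?Pd ?dotv0; lra.
Qed.

Definition paired_coord (i : 'I_p) : 'cV[R]_(p + p) :=
  delta_mx (lshift p i) ord0 + delta_mx (rshift p i) ord0.

Lemma constr_paired_coord i :
  constr D (0, paired_coord i) = 0 :> 'cV[R]_p.
Proof.
apply/colP => j; rewrite /constr /= mulmx0 add0r Itilde_mul !mxE !eqxx.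
by rewrite !andbT eq_lshift eq_rshift eq_lrshift eq_rlshift addr0 add0r subrr.
Qed.

Lemma slope_paired_coord w i : slope w (0, paired_coord i) = 2 * lambda.
Proof.
rewrite /quad_slope /= dotv0 add0r dotv_evec /paired_coord.
under eq_bigr do rewrite !mxE eqxx !andbT.
have sum1 (a : 'I_(p + p)) : \sum_j (j == a)%:R = 1 :> R.
  by rewrite (bigD1 a) //= eqxx big1 ?addr0 // => j /negPf ->.
by rewrite big_split /= !sum1; ring.
Qed.

(** Otherwise both coordinates could be lowered by the same amount: the
    constraint is kept and the objective drops at rate [2 * lambda]. *)
Lemma solution_complementary w i : solution w ->
  0 < w.2 (lshift p i) ord0 -> w.2 (rshift p i) ord0 = 0.
Proof.
move=> /primal_solutionsP[[w0 cw] wmin] wl.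
apply/eqP; rewrite eq_le w0 andbT leNgt; apply/negP => wr.
pose t := Num.min (w.2 (lshift p i) ord0) (w.2 (rshift p i) ord0).
have t0 : 0 < t by rewrite lt_min wl.
have : quad w <= quad (w + (- t) *: (0, paired_coord i)).
  apply: wmin; split; last first.
    by rewrite linearD linearZ /= constr_paired_coord cw scaler0 addr0.
  move=> j /=; rewrite !mxE eqxx !andbT.
  have [->|jl] := eqVneq j (lshift p i).
    by rewrite eq_lrshift addr0 mulr1 subr_ge0 ge_min lexx.
  have [->|jr] := eqVneq j (rshift p i).
    by rewrite add0r mulr1 subr_ge0 ge_min lexx orbT.
  by rewrite addr0 mulr0 addr0.
rewrite quad_along slope_paired_coord /= mulmx0 dotv0 !mulr0 addr0.
by have := mulr_gt0 t0 lambda_gt0; lra.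
Qed.

(** The cheapest [z] for a given [x]: the negative and positive parts of
    [D^T x], for which [\sum_i z_i] equals the l1 norm of [D^T x]. *)
Definition split_parts (x : 'cV[R]_n) : 'cV[R]_(p + p) :=
  col_mx (map_mx (fun t => Num.max 0 (- t)) (D^T *m x))
         (map_mx (fun t => Num.max 0 t) (D^T *m x)).

Lemma feasible_split_parts x : feasible D (x, split_parts x).
Proof.
split=> [i|].
  by rewrite /split_parts mxE; case: splitP => j _; rewrite mxE le_max lexx.
apply/colP => j; rewrite mxE Itilde_mul /split_parts col_mxEu col_mxEd /=.
rewrite [RHS]mxE [X in _ + (X - _)]mxE [X in _ + (_ - X)]mxE.
set t := _ j ord0.
by case: (leP 0 t) => h1; case: (leP 0 (- t)) => h2; lra.
Qed.

Lemma quad_split_parts x :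
  quad (x, split_parts x) = lasso_objective Phi y D lambda x - 2^-1 * dotv y y.
Proof.
rewrite quad_residual /lasso_objective norm2_sqr /= addrAC.
congr (_ + _ * _ - _).
rewrite big_split_ord /= -big_split; apply: eq_bigr => i _ /=.
rewrite /split_parts col_mxEu col_mxEd [X in X + _]mxE [X in _ + X]mxE.
set t := _ i ord0.
by case: (leP 0 t) => h1; case: (leP 0 (- t)) => h2;
  [rewrite ger0_norm | rewrite ger0_norm | rewrite ltr0_norm
  | rewrite ltr0_norm]; lra.
Qed.

Lemma quad_ge_lasso w : feasible D w ->
  lasso_objective Phi y D lambda w.1 - 2^-1 * dotv y y <= quad w.
Proof.
move=> [w0 cw]; rewrite quad_residual /lasso_objective norm2_sqr addrAC.
rewrite lerD2l ler_pM2l // big_split_ord /= -big_split.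
apply: ler_sum => i _ /=; rewrite (constr_coord _ cw).
have := w0 (lshift p i); have := w0 (rshift p i).
by rewrite ler_norml; lra.
Qed.

Lemma lasso_solutionsP x :
  lasso_solutions Phi y D lambda x <-> solution (x, split_parts x).
Proof.
split=> [[_ xmin]|/primal_solutionsP[_ xmin]].
  apply/primal_solutionsP; split=> [|w' fw']; first exact: feasible_split_parts.
  apply: le_trans (quad_ge_lasso fw').
  by rewrite quad_split_parts lerD2r; exact: xmin.
split=> // x' _; have := xmin _ (feasible_split_parts x').
by rewrite !quad_split_parts lerD2r.
Qed.

Lemma solution_lasso w : solution w -> lasso_solutions Phi y D lambda w.1.
Proof.
move=> /primal_solutionsP[fw wmin]; split=> // x' _.
have := wmin _ (feasible_split_parts x'); rewrite quad_split_parts.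
by have := quad_ge_lasso fw; lra.
Qed.

End PrimalSolutions.

(** * Compactness and cluster points *)

Section Compactness.
Context {R : realType}.

Lemma trmx_continuous m k : continuous (@trmx R m k).
Proof.
move=> M s /= /(nbhs_ballP (M^T)) [e e0 es].
apply/nbhs_ballP; exists e => //= N [_ MN]; apply: es; split=> // i j.
by rewrite !mxE; exact: MN.
Qed.

Lemma compact_cV_box m (M : R) :
  compact [set v : 'cV[R]_m | forall i, `|v i ord0| <= M].
Proof.
rewrite (_ : mkset _ =
    trmx @` [set v : 'rV[R]_m | forall i, `[- M, M]%classic (v ord0 i)]).
  apply: continuous_compact.
    by apply: continuous_subspaceT; exact: trmx_continuous.
  apply: (@rV_compact R m (fun=> `[- M, M]%classic)) => i.
  exact: segment_compact.
apply/seteqP; split=> [v vM|_ [v vM <-] i].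
  exists v^T; last by rewrite trmxK.
  by move=> i; rewrite /= in_itv /= mxE -ler_norml.
by have := vM i; rewrite /= in_itv /= mxE -ler_norml.
Qed.

Definition box n m (M : R) : set ('cV[R]_n * 'cV[R]_m) :=
  [set w : 'cV[R]_n * 'cV[R]_m |
    (forall i, `|w.1 i ord0| <= M) /\ (forall i, `|w.2 i ord0| <= M)].

Lemma compact_box n m (M : R) : compact (@box n m M).
Proof.
exact: (compact_setX (@compact_cV_box n M) (@compact_cV_box m M)).
Qed.

Lemma fst_coord_continuous n m (i : 'I_n) :
  continuous (fun w : 'cV[R]_n * 'cV[R]_m => w.1 i ord0).
Proof.
move=> w; apply: (@continuous_comp _ _ _ fst (fun v : 'cV[R]_n => v i ord0)).
  exact: cvg_fst.
exact: coord_continuous.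
Qed.

Lemma snd_coord_continuous n m (i : 'I_m) :
  continuous (fun w : 'cV[R]_n * 'cV[R]_m => w.2 i ord0).
Proof.
move=> w; apply: (@continuous_comp _ _ _ snd (fun v : 'cV[R]_m => v i ord0)).
  exact: cvg_snd.
exact: coord_continuous.
Qed.

Lemma sum_continuous (T : topologicalType) (I : Type) (r : seq I) (P : pred I)
    (F : I -> T -> R) (x : T) : (forall i, P i -> {for x, continuous (F i)}) ->
  {for x, continuous (fun t => \sum_(i <- r | P i) F i t)}.
Proof. by move=> Fc; apply: cvg_big => //; exact: add_continuous. Qed.

Lemma prod_continuous (T : topologicalType) (I : Type) (r : seq I) (P : pred I)
    (F : I -> T -> R) (x : T) : (forall i, P i -> {for x, continuous (F i)}) ->
  {for x, continuous (fun t => \prod_(i <- r | P i) F i t)}.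
Proof. by move=> Fc; apply: cvg_big => //; exact: mul_continuous. Qed.

Lemma closed_sublevel (T : topologicalType) (g : T -> R) c :
  continuous g -> closed [set t | g t <= c].
Proof. by move=> /continuous_closedP /(_ _ (@closed_le R c)). Qed.

Lemma closed_level (T : topologicalType) (g : T -> R) c :
  continuous g -> closed [set t | g t = c].
Proof. by move=> /continuous_closedP /(_ _ (@closed_eq R c)). Qed.

Lemma closed_forall (T : topologicalType) (I : Type) (A : I -> set T) :
  (forall i, closed (A i)) -> closed [set t | forall i, A i t].
Proof.
move=> Ac; rewrite (_ : mkset _ = \bigcap_(i in setT) A i).
  by apply: closed_bigI => i _; exact: Ac.
by apply/seteqP; split=> t /= At i; [move=> _; exact: At | exact: At].
Qed.

(** If some neighbourhood [U] of [x] were not in [F], the trace of [F] on the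
    complement of [U] would be a proper filter on [K]; its cluster point would
    be a cluster point of [F] in [K] other than [x]. *)
Lemma cvg_compact_cluster (T : topologicalType) (F : set_system T) (K : set T)
    (x : T) {FF : ProperFilter F} : compact K -> F K ->
  (forall t, K t -> cluster F t -> t = x) -> F --> x.
Proof.
move=> Kc FK Fx U Ux; apply: contrapT => FU.
have PW : ProperFilter (within (~` U) F).
  apply: Build_ProperFilter_ex => P WP; apply: contrapT => nP; apply: FU.
  rewrite /within /= in WP; apply: filterS WP => t Pt.
  by apply: contrapT => nU; apply: nP; exists t; exact: Pt.
have [|t [Kt clt]] := Kc (within (~` U) F) PW.
  by rewrite /within /=; apply: filterS FK => s Ks _.
have tx : t = x.
  apply: Fx => // A B FA Bt; apply: clt => //.
  by rewrite /within /=; apply: filterS FA => s As _.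
rewrite tx in clt.
by have [s []] := clt (~` U) U (withinT _ FF) Ux.
Qed.

Lemma cluster_le (T : topologicalType) (F : set_system T) (g : T -> R) x c :
  cluster F x -> {for x, continuous g} -> F [set t | g t <= c] -> g x <= c.
Proof.
move=> Fx gx Fg; rewrite leNgt; apply/negP => gc.
have nx : nbhs x (g @^-1` [set r | c < r]).
  by apply: gx; apply: open_nbhs_nbhs; split=> //; exact: open_gt.
by have [t [/=]] := Fx _ _ Fg nx; rewrite leNgt => /negP.
Qed.

End Compactness.

(** * Coercivity and continuity of the primal objective *)

Section Coercivity.
Context {R : realType} {n p q : nat}.
Variables (Phi : 'M[R]_(q, n)) (y : 'cV[R]_q) (D : 'M[R]_(n, p)).
Hypothesis ker_inj :
  forall x : 'cV[R]_n, D^T *m x = 0 -> Phi *m x = 0 -> x = 0.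
Implicit Types (w d : 'cV[R]_n * 'cV[R]_(p + p)) (z : 'cV[R]_(p + p)).

(** The hypothesis makes the block matrix with rows [D^T] and [Phi] injective,
    so it has a left inverse; [K] is the sum of the absolute values of the
    entries of that inverse. *)
Lemma ker_bound : exists2 K : R, 0 <= K & forall (x : 'cV[R]_n) T, 0 <= T ->
  (forall i, `|(D^T *m x) i ord0| <= T) ->
  (forall i, `|(Phi *m x) i ord0| <= T) ->
  forall i, `|x i ord0| <= K * T.
Proof.
have /row_freeP[B AB] : row_free (row_mx D Phi^T).
  apply: inj_row_free => v.
  rewrite mul_mx_row -[RHS]row_mx0 => /eq_row_mx[vD vP].
  apply: trmx_inj; rewrite trmx0; apply: ker_inj; last rewrite -[Phi]trmxK;
  by rewrite -trmx_mul ?vD ?vP trmx0.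
exists (\sum_i \sum_j `|B j i|) => [|x T T_ge0 xD xP i].
  by apply: sumr_ge0 => i _; apply: sumr_ge0.
have -> : x i ord0 = ((x^T *m row_mx D Phi^T) *m B) ord0 i.
  by rewrite -mulmxA AB mulmx1 mxE.
rewrite mxE mul_mx_row.
have T0 j : `|row_mx (x^T *m D) (x^T *m Phi^T) ord0 j| <= T.
  rewrite -[D]trmxK -!trmx_mul mxE.
  by case: splitP => k _; rewrite mxE.
apply: (@le_trans _ _ (\sum_j `|B j i| * T)).
  apply: le_trans (ler_norm_sum _ _ _) _; apply: ler_sum => j _.
  by rewrite normrM mulrC ler_wpM2l.
rewrite -mulr_suml; apply: ler_wpM2r => //.
rewrite [leRHS](bigD1 i) //= lerDl.
by apply: sumr_ge0 => k _; apply: sumr_ge0.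
Qed.

(** Bounds [z] through its sum, hence [D^T x] through the constraint, hence [x]
    through [D^T x] and [Phi x]. *)
Lemma coercive (eps C : R) : 0 < eps -> exists M : R, forall w, feasible D w ->
  2^-1 * dotv (y - Phi *m w.1) (y - Phi *m w.1)
    + eps * \sum_i w.2 i ord0 <= C ->
  box M w.
Proof.
move=> eps0; have [K K0 Kb] := ker_bound.
(* [C / eps] bounds the [z_i], and [1 + 2 * C] the entries of the residual,
   whose squares are at most [2 * C]. *)
pose T := C / eps + (1 + 2 * C + norm1 y).
exists (K * T + T) => w [w0 cw] wC.
have s0 : 0 <= \sum_i w.2 i ord0 by apply: sumr_ge0.
have r0 := dotv_ge0 (y - Phi *m w.1).
have es0 := mulr_ge0 (ltW eps0) s0.
have C0 : 0 <= C by lra.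
have Ce0 : 0 <= C / eps by rewrite divr_ge0 // ltW.
have y0 : 0 <= norm1 y by apply: sumr_ge0.
have zT i : w.2 i ord0 <= C / eps.
  rewrite ler_pdivlMr // mulrC.
  apply: (@le_trans _ _ (eps * \sum_i w.2 i ord0)).
    rewrite ler_pM2l // (bigD1 i) //= lerDl.
    by apply: sumr_ge0.
  by lra.
have T0 : 0 <= T by rewrite /T; lra.
split=> i; last first.
  rewrite ger0_norm //; have := zT i; have := mulr_ge0 K0 T0.
  by rewrite /T; lra.
apply: (@le_trans _ _ (K * T)); last by lra.
apply: Kb => // j.
  rewrite (constr_coord _ cw) ler_norml.
  have := zT (lshift p j); have := zT (rshift p j).
  have := w0 (lshift p j); have := w0 (rshift p j).
  by rewrite /T; lra.
have yj : `|y j ord0| <= norm1 y.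
  by rewrite /norm1 (bigD1 j) //= lerDl; apply: sumr_ge0.
have rj : (y j ord0 - (Phi *m w.1) j ord0) ^+ 2 <= 2 * C.
  have := dotv_coord (y - Phi *m w.1) j.
  by rewrite mxE [X in (_ + X) ^+ 2]mxE; lra.
move: yj; rewrite !ler_norml /T => /andP[y1 y2].
by apply/andP; split; nra.
Qed.

Lemma quad_continuous lambda : continuous (quad_value Phi y lambda :
  'cV[R]_n * 'cV[R]_(p + p) -> R).
Proof.
move=> w; rewrite (_ : quad_value _ _ _ = fun v : 'cV[R]_n * 'cV[R]_(p + p) =>
  2^-1 * (\sum_i (y i ord0 - \sum_j Phi i j * v.1 j ord0) *
                 (y i ord0 - \sum_j Phi i j * v.1 j ord0))
  - 2^-1 * dotv y y + lambda * \sum_i v.2 i ord0); last first.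
  apply/funext => v; rewrite quad_residual; congr (_ * _ - _ + _).
  by apply: eq_bigr => i _; rewrite !mxE.
have resc i : {for w, continuous (fun v : 'cV[R]_n * 'cV[R]_(p + p) =>
    y i ord0 - \sum_j Phi i j * v.1 j ord0)}.
  apply: cvgB; first exact: cvg_cst.
  apply: sum_continuous => j _; apply: cvgM; first exact: cvg_cst.
  exact: fst_coord_continuous.
apply: cvgD.
  apply: cvgB; last exact: cvg_cst.
  apply: cvgM; first exact: cvg_cst.
  by apply: sum_continuous => i _; apply: cvgM; exact: resc.
apply: cvgM; first exact: cvg_cst.
by apply: sum_continuous => i _; exact: snd_coord_continuous.
Qed.

Lemma closed_feasible : closed (@feasible R n p D).
Proof.
apply: closedI.
  apply: (@closed_forall _ _ (fun i => [set w : 'cV[R]_n * 'cV[R]_(p + p) |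
    0 <= w.2 i ord0])) => i.
  rewrite [X in closed X](_ : _ =
    [set w : 'cV[R]_n * 'cV[R]_(p + p) | - w.2 i ord0 <= 0]).
    apply: closed_sublevel => w.
    apply: (@cvgN _ R^o); exact: snd_coord_continuous.
  by apply/seteqP; split=> w /=; rewrite oppr_le0.
rewrite [X in closed X](_ : _ = [set w : 'cV[R]_n * 'cV[R]_(p + p) |
    forall i, (constr D w) i ord0 = 0]); last first.
  apply/seteqP; split=> [w /= -> i|w /= cw]; first by rewrite mxE.
  by apply/colP => i; rewrite cw mxE.
apply: (@closed_forall _ _ (fun i =>
  [set w : 'cV[R]_n * 'cV[R]_(p + p) | (constr D w) i ord0 = 0])) => i.
apply: closed_level.
rewrite (_ : (fun w => _) = fun w : 'cV[R]_n * 'cV[R]_(p + p) =>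
  \sum_j D^T i j * w.1 j ord0
    + (w.2 (lshift p i) ord0 - w.2 (rshift p i) ord0));
  last first.
  by apply/funext => w; rewrite mxE Itilde_mul [X in X + _]mxE.
move=> w; apply: cvgD.
  apply: sum_continuous => j _; apply: cvgM; first exact: cvg_cst.
  exact: fst_coord_continuous.
by apply: cvgB; exact: snd_coord_continuous.
Qed.

End Coercivity.

(** * Elementary bounds for the logarithm *)

Section LnBounds.
Context {R : realType}.

Lemma ln_prod (I : finType) (F : I -> R) : (forall i, 0 < F i) ->
  0 < \prod_i F i /\ ln (\prod_i F i) = \sum_i ln (F i).
Proof.
move=> F0; apply: (big_ind2 (fun a b => 0 < a /\ ln a = b)).
- by rewrite ln1.
- move=> a la b lb [a0 <-] [b0 <-]; split; first exact: mulr_gt0.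
  by rewrite lnM.
- by [].
Qed.

Lemma ln_le_subr1 (t : R) : 0 < t -> ln t <= t - 1.
Proof.
move=> t0; have -> : t = 1 + (t - 1) by ring.
by apply: le_trans (le_ln1Dx _) _; lra.
Qed.

Lemma ln_le_affine (a t : R) : 0 < a -> 0 < t -> ln t <= a * t - 1 - ln a.
Proof.
move=> a0 t0; have := ln_le_subr1 (mulr_gt0 a0 t0).
by rewrite lnM //; lra.
Qed.

(** A lower bound with the right first order term, obtained from
    [ln t <= t - 1] at [t = (1 + s)^-1]. *)
Lemma ln1D_ge (s : R) : - 2^-1 <= s -> s - 2 * s ^+ 2 <= ln (1 + s).
Proof.
move=> s0; have s1 : 0 < 1 + s by lra.
have := ln_le_subr1 (_ : 0 < (1 + s)^-1); rewrite invr_gt0 => /(_ s1).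
rewrite lnV // => h.
suff : s - 2 * s ^+ 2 <= 1 - (1 + s)^-1 by lra.
have -> : 1 - (1 + s)^-1 = s / (1 + s) by field; lra.
rewrite ler_pdivlMr //; nra.
Qed.

Lemma ge0_of_small (L C t0 : R) : 0 < t0 ->
  (forall t, 0 < t <= t0 -> 0 <= L + t * C) -> 0 <= L.
Proof.
move=> t00 LC; rewrite leNgt; apply/negP => L0.
pose t := Num.min t0 (- L / (2 * (1 + `|C|))).
have C0 := normr_ge0 C.
have tp : 0 < t.
  by rewrite lt_min t00 /= divr_gt0 //; lra.
have t2 : t * (2 * (1 + `|C|)) <= - L.
  rewrite -ler_pdivlMr; last by lra.
  by rewrite ge_min lexx orbT.
have := LC t; rewrite tp ge_min lexx => /(_ isT).
have := ler_norm C; nra.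
Qed.

End LnBounds.

(** * Existence and stationarity of the central path *)

Section CentralPath.
Context {R : realType} {n p q : nat}.
Variables (Phi : 'M[R]_(q, n)) (y : 'cV[R]_q) (D : 'M[R]_(n, p)) (lambda : R).
Hypothesis p_gt0 : (0 < p)%N.
Hypothesis lambda_gt0 : 0 < lambda.
Hypothesis ker_inj :
  forall x : 'cV[R]_n, D^T *m x = 0 -> Phi *m x = 0 -> x = 0.
Implicit Types (w d : 'cV[R]_n * 'cV[R]_(p + p)) (z : 'cV[R]_(p + p)).

Local Notation quad := (quad_value Phi y lambda).
Local Notation slope := (quad_slope Phi y lambda).

Definition strictly_feasible w : Prop :=
  (forall i, 0 < w.2 i ord0) /\ constr D w = 0.

Lemma strictly_feasibleW w : strictly_feasible w -> feasible D w.
Proof. by move=> [w0 cw]; split=> // i; exact: ltW. Qed.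

Definition barrier_weight (mu : R) : R := mu / (2 * p)%:R.

Lemma weight_gt0 (mu : R) : 0 < mu -> 0 < barrier_weight mu.
Proof. by move=> mu0; rewrite divr_gt0 // ltr0n muln_gt0. Qed.

Lemma weightK (mu : R) : barrier_weight mu * (p + p)%:R = mu.
Proof.
rewrite /barrier_weight mul2n -addnn divfK //.
by rewrite pnatr_eq0 -lt0n addn_gt0 p_gt0.
Qed.

(** [F_mu] on strictly feasible points up to the constant [mu * ln mu]. *)
Definition penalized mu w : R :=
  quad w - barrier_weight mu * \sum_i ln (w.2 i ord0).

Lemma penalized_objective_fin (mu : R) w : 0 < mu -> strictly_feasible w ->
  penalized_objective Phi y D lambda mu w = (penalized mu w + mu * ln mu)%:E.
Proof.
move=> mu0 [w0 cw]; rewrite /penalized_objective primal_objective_fin //.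
have sw0 i : 0 < (mu^-1 *: w.2) i ord0 by rewrite mxE mulr_gt0 ?invr_gt0.
rewrite /barrier ifT; last exact/forallP.
rewrite -EFinM -EFinD ln_powR; congr (_%:E).
have [_ ->] := ln_prod sw0.
under eq_bigr do rewrite mxE lnM ?posrE ?invr_gt0 // lnV ?posrE //.
rewrite big_split /= sumr_const card_ord -(mulr_natr (- ln mu)).
rewrite /penalized /barrier_weight mul2n -addnn.
have : (p + p)%:R != 0 :> R by rewrite pnatr_eq0 -lt0n addn_gt0 p_gt0.
by move=> N0; field; rewrite -natrD.
Qed.

Lemma penalized_objective_pinfty (mu : R) w : 0 < mu -> ~ strictly_feasible w ->
  penalized_objective Phi y D lambda mu w = +oo%E.
Proof.
move=> mu0 nw; rewrite /penalized_objective.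
have [cw|cw] := pselect (constr D w = 0).
  rewrite primal_objective_fin // /barrier ifF ?gt0_muley ?lte_fin //.
  apply/negP => /forallP w0; apply: nw; split=> // i.
  by have := w0 i; rewrite mxE pmulr_rgt0 ?invr_gt0.
rewrite primal_objective_pinfty // /barrier; case: ifP => _ //.
by rewrite gt0_muley ?lte_fin.
Qed.

Lemma strictly_feasible_evec : strictly_feasible (0, evec (R := R)).
Proof.
split=> [i|]; first by rewrite mxE.
by apply/colP => i; rewrite /constr mulmx0 add0r Itilde_mul !mxE subrr.
Qed.

(** The sum of logarithms is unbounded near the boundary of the orthant, so
    [expR (- f / kappa) * \prod_i z_i] is maximized instead: it is continuous,
    equals [expR (- F_mu / kappa)] up to a constant factor where all [z_i] are
    positive, and vanishes elsewhere on the feasible set, so its maximizer on a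
    compact piece of that set is interior. *)
Lemma penalized_attains_min (mu : R) : 0 < mu ->
  exists w, strictly_feasible w /\
  forall w', strictly_feasible w' -> penalized mu w <= penalized mu w'.
Proof.
move=> mu0; have k0 := weight_gt0 mu0; set k := barrier_weight mu in k0.
(* [k * a = lambda / 2]: with this [a], half of the term [lambda * z_i]
   dominates the logarithm. *)
pose a := lambda / (2 * k).
have a0 : 0 < a by rewrite divr_gt0 //; lra.
pose b := k * (1 + ln a).
have lnb (t : R) : 0 < t -> k * ln t <= lambda / 2 * t - b.
  move=> t0; have := ln_le_affine a0 t0; rewrite -(ler_pM2l k0).
  suff -> : k * (a * t - 1 - ln a) = lambda / 2 * t - b by [].
  by rewrite /b /a; field; rewrite gt_eqF.
pose w0 : 'cV[R]_n * 'cV[R]_(p + p) := (0, evec (R := R)).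
have sw0 : strictly_feasible w0 := strictly_feasible_evec.
have l20 : 0 < lambda / 2 by rewrite divr_gt0.
have [M MP] := coercive y ker_inj
  (penalized mu w0 + 2^-1 * dotv y y - \sum_(i < p + p) b) l20.
pose K : set ('cV[R]_n * 'cV[R]_(p + p)) := @box R _ _ M `&` @feasible R n p D.
have lowK w : strictly_feasible w -> penalized mu w <= penalized mu w0 -> K w.
  move=> sw wle; have fw := strictly_feasibleW sw; split=> //; apply: MP => //.
  have : k * (\sum_i ln (w.2 i ord0)) <=
      lambda / 2 * \sum_i w.2 i ord0 - \sum_(i < p + p) b.
    rewrite !mulr_sumr -sumrB; apply: ler_sum => i _; apply: lnb; exact: sw.1.
  by move: wle; rewrite {1}/penalized quad_residual -/k; lra.
pose psi w := expR (- k^-1 * quad w) * \prod_i w.2 i ord0.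
have psiE w : strictly_feasible w -> psi w = expR (- k^-1 * penalized mu w).
  move=> [sw _]; rewrite /psi /penalized -/k.
  have [pr0 lnp] := ln_prod sw.
  by rewrite -[X in _ * X]lnK // lnp -expRD; congr expR; field; rewrite gt_eqF.
have psic : continuous psi.
  move=> w; apply: cvgM.
    apply: (@continuous_comp _ _ _ (fun w => - k^-1 * quad w) (@expR R));
      last exact: continuous_expR.
    by apply: cvgM; [exact: cvg_cst | exact: quad_continuous].
  by apply: prod_continuous => i _; exact: snd_coord_continuous.
have K0 : K w0 by exact: lowK.
have cK : compact K.
  by apply: compact_closedI; [exact: compact_box | exact: closed_feasible].
have [c /set_mem cKc cmax] := compact_EVT_max (ex_intro _ w0 K0 : K !=set0) cK
  (continuous_subspaceT psic).
have sc : strictly_feasible c.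
  split; last exact: cKc.2.2.
  have : 0 < psi c.
    by apply: lt_le_trans (cmax w0 (mem_set K0)); rewrite psiE // expR_gt0.
  rewrite /psi pmulr_rgt0 ?expR_gt0 // => pc i.
  rewrite lt_neqAle cKc.2.1 andbT eq_sym; apply: contraTneq pc => ci.
  by rewrite (bigD1 i) //= ci mul0r ltxx.
have cle w : K w -> strictly_feasible w -> penalized mu c <= penalized mu w.
  move=> Kw sw; have := cmax w (mem_set Kw); rewrite !psiE // ler_expR.
  by rewrite !mulNr lerN2 ler_pM2l ?invr_gt0.
exists c; split=> // w sw.
have [le0|/ltW gt0] := leP (penalized mu w) (penalized mu w0).
  by apply: cle => //; exact: lowK.
exact: le_trans (cle _ K0 sw0) gt0.
Qed.

Lemma central_path_min (mu : R) : 0 < mu ->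
  strictly_feasible (central_path Phi y D lambda mu) /\
  forall w, strictly_feasible w ->
    penalized mu (central_path Phi y D lambda mu) <= penalized mu w.
Proof.
move=> mu0; rewrite /central_path; case: xgetP => [w _ [_ wmin]|noarg].
  have sw : strictly_feasible w.
    apply: contrapT => nw; have := wmin _ I; move=> /(_ (0, evec (R := R))).
    rewrite (penalized_objective_pinfty mu0 nw).
    by rewrite penalized_objective_fin // ; exact: strictly_feasible_evec.
  split=> // w' sw'; have := wmin w' I.
  by rewrite !penalized_objective_fin // lee_fin lerD2r.
have [w [sw wmin]] := penalized_attains_min mu0.
exfalso; apply: (noarg w); split=> // w' _.
rewrite (penalized_objective_fin mu0 sw).
have [sw'|nw'] := pselect (strictly_feasible w').
  by rewrite penalized_objective_fin // lee_fin lerD2r wmin.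
by rewrite penalized_objective_pinfty // leey.
Qed.

(** Moving by [t *: d] changes [penalized] by at most
    [t * (slope - weight * \sum_i a_i) + O(t ^ 2)] with [a_i = d_i / z_i], so
    minimality forces the coefficient of [t] to be nonnegative; applying this to
    [- d] as well gives equality. *)
Lemma central_path_stationary (mu : R) d : 0 < mu -> constr D d = 0 ->
  slope (central_path Phi y D lambda mu) d =
  barrier_weight mu *
    \sum_i d.2 i ord0 / (central_path Phi y D lambda mu).2 i ord0.
Proof.
move=> mu0; have [sw wmin] := central_path_min mu0.
set w := central_path Phi y D lambda mu in sw wmin *.
have k0 := weight_gt0 mu0; set k := barrier_weight mu in k0 *.
suff ge d' : constr D d' = 0 ->
    k * (\sum_i d'.2 i ord0 / w.2 i ord0) <= slope w d'.
  move=> cd; apply/le_anti/andP; split; last exact: ge.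
  have := ge (- d); rewrite linearN /= cd oppr0 => /(_ erefl).
  have -> : slope w (- d) = - slope w d.
    by rewrite /quad_slope /= !dotvNr; ring.
  under eq_bigr do rewrite mxE mulNr.
  by rewrite sumrN mulrN lerN2.
move: d' => {}d cd.
pose a i := d.2 i ord0 / w.2 i ord0.
pose S := \sum_i `|a i|.
have aS i : `|a i| <= S.
  by rewrite /S (bigD1 i) //= lerDl; apply: sumr_ge0.
have S0 : 0 <= S by apply: sumr_ge0.
rewrite -subr_ge0.
(* For [t] up to this bound [|t * a i| <= 1/2], which keeps [w + t *: d]
   strictly feasible and makes [ln1D_ge] applicable. *)
apply: (@ge0_of_small _ _
  (2^-1 * dotv (Phi *m d.1) (Phi *m d.1) + k * (2 * \sum_i a i ^+ 2))
  (2 * (1 + S))^-1) => [|t /andP[t0 t1]].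
  by rewrite invr_gt0; lra.
have ta i : `|t * a i| <= 2^-1.
  rewrite normrM gtr0_norm //.
  have tS : t * (2 * (1 + S)) <= 1 by rewrite -ler_pdivlMr ?div1r //; lra.
  by have := aS i; have := normr_ge0 (a i); nra.
have ta1 i : 0 < 1 + t * a i by have := ta i; rewrite ler_norml; lra.
have coordE i : (w + t *: d).2 i ord0 = w.2 i ord0 * (1 + t * a i).
  by rewrite /= !mxE /a; field; rewrite gt_eqF //; exact: sw.1.
have swt : strictly_feasible (w + t *: d).
  split=> [i|]; first by rewrite coordE mulr_gt0 //; exact: sw.1.
  by rewrite linearD linearZ /= cd sw.2 scaler0 addr0.
have := wmin _ swt; rewrite /penalized quad_along -/k.
have -> : \sum_i ln ((w + t *: d).2 i ord0) =
    \sum_i ln (w.2 i ord0) + \sum_i ln (1 + t * a i).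
  rewrite -big_split; apply: eq_bigr => i _.
  by rewrite coordE lnM // posrE //; exact: sw.1.
rewrite -[\sum_i d.2 i ord0 / _]/(\sum_i a i).
set Sa := \sum_i a i; set Sb := \sum_i a i ^+ 2; set N := dotv _ _.
set L := \sum_i ln (w.2 i ord0); set L1 := \sum_i ln (1 + _) => h2.
have h1 : t * Sa - 2 * t ^+ 2 * Sb <= L1.
  rewrite /Sa /Sb !mulr_sumr -sumrB; apply: ler_sum => i _.
  rewrite -mulrA -exprMn; apply: ln1D_ge.
  by have := ta i; rewrite ler_norml; lra.
rewrite -(ler_pM2l k0) in h1.
rewrite -(pmulr_rge0 _ t0).
suff -> : t * (slope w d - k * Sa + t * (2^-1 * N + k * (2 * Sb))) =
  (quad w + t * slope w d + t ^+ 2 * (2^-1 * N) - k * (L + L1)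
   - (quad w - k * L)) + (k * L1 - k * (t * Sa - 2 * t ^+ 2 * Sb)).
  by rewrite addr_ge0 // subr_ge0.
by ring.
Qed.

End CentralPath.

(** * The equality case of the mean inequality *)

Section GeometricMean.
Context {R : realType}.

(** The arithmetic mean of the ratios [u_i / v_i] over [I] is 1, so their
    product is at most 1, with equality only if all ratios coincide, that is,
    are 1. *)
Lemma geomean_ratio_sum m (I : {set 'I_m}) (u v : 'cV[R]_m) :
  (forall i, 0 <= u i ord0) -> (forall i, i \in I -> 0 < v i ord0) ->
  \sum_(i in I) u i ord0 / v i ord0 = #|I|%:R ->
  (geomean I u <= geomean I v)%E /\
  ((geomean I v <= geomean I u)%E -> forall i, i \in I -> u i ord0 = v i ord0).
Proof.
move=> u0 v0 uv; rewrite /geomean.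
have -> : [forall i in I, 0 < v i ord0] by apply/forall_inP.
have [I0|In0] := posnP #|I|.
  have Ie i : i \in I = false.
    by move/eqP: I0; rewrite cards_eq0 => /eqP ->; rewrite inE.
  rewrite I0 invr0 !powRr0; split=> [|_ i]; last by rewrite Ie.
  by case: ifP => _; rewrite ?leNye.
have cI : #|I|%:R != 0 :> R by rewrite pnatr_eq0 -lt0n.
have [|le1 eq1] := leif_AGM (A := mem I) (E := fun i => u i ord0 / v i ord0).
  by move=> i iI; rewrite divr_ge0 // ltW // v0.
rewrite /= in le1 eq1.
have prodE : \prod_(i in I) (u i ord0 / v i ord0) =
  (\prod_(i in I) u i ord0) / \prod_(i in I) v i ord0 by rewrite prodf_div.
rewrite uv divff // expr1n in le1 eq1.
have pv : 0 < \prod_(i in I) v i ord0 by apply: prodr_gt0.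
have pu : 0 <= \prod_(i in I) u i ord0 by apply: prodr_ge0.
have puv : \prod_(i in I) u i ord0 <= \prod_(i in I) v i ord0.
  by move: le1; rewrite prodE ler_pdivrMr // mul1r.
split.
  case: ifP => _; last exact: leNye.
  by rewrite lee_fin ge0_ler_powR ?nnegrE ?invr_ge0 // ltW.
case: ifP => [up|_]; last by [].
rewrite lee_fin => pvu i iI.
have {}pvu : \prod_(i in I) v i ord0 <= \prod_(i in I) u i ord0.
  rewrite leNgt; apply/negP => lt; move: pvu; rewrite leNgt => /negP; apply.
  by rewrite gt0_ltr_powR ?nnegrE ?invr_gt0 ?ltr0n // ltW.
have /esym : (\prod_(i in I) (u i ord0 / v i ord0) == 1).
  by rewrite prodE (le_anti (introT andP (conj puv pvu))) divff // gt_eqF.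
rewrite eq1 => /esym /forall_inP/(_ i iI)/forall_inP Eeq.
have : \sum_(j in I) u j ord0 / v j ord0 = #|I|%:R * (u i ord0 / v i ord0).
  rewrite (eq_bigr (fun=> u i ord0 / v i ord0)).
    by rewrite sumr_const mulr_natl.
  by move=> j jI; rewrite (eqP (Eeq j jI)).
rewrite uv -[LHS]mulr1 => /(mulfI cI) ratio1.
by rewrite -[RHS]mul1r ratio1 divfK // gt_eqF // v0.
Qed.

End GeometricMean.

(** * Cluster points of the central path *)

Section Cluster.
Context {R : realType} {n p q : nat}.
Variables (Phi : 'M[R]_(q, n)) (y : 'cV[R]_q) (D : 'M[R]_(n, p)) (lambda : R).
Hypothesis p_gt0 : (0 < p)%N.
Hypothesis lambda_gt0 : 0 < lambda.
Hypothesis ker_inj :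
  forall x : 'cV[R]_n, D^T *m x = 0 -> Phi *m x = 0 -> x = 0.
Implicit Types (mu : R) (w d : 'cV[R]_n * 'cV[R]_(p + p)) (z : 'cV[R]_(p + p)).

Local Notation quad := (quad_value Phi y lambda).
Local Notation solution := (primal_solutions Phi y D lambda).
Local Notation weight := (@barrier_weight R p).
Local Notation cpath := (central_path Phi y D lambda).
Local Notation I := (Ibar Phi y D lambda).
Local Notation stationary :=
  (central_path_stationary y p_gt0 lambda_gt0 ker_inj).

Lemma central_path_gt0 mu i : 0 < mu -> 0 < (cpath mu).2 i ord0.
Proof. by move=> /(central_path_min y p_gt0 lambda_gt0 ker_inj)[[]]. Qed.

Lemma central_path_constr mu : 0 < mu -> constr D (cpath mu) = 0.
Proof. by move=> /(central_path_min y p_gt0 lambda_gt0 ker_inj)[[]]. Qed.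

Lemma central_path_feasible mu : 0 < mu -> feasible D (cpath mu).
Proof.
move=> mu0; split=> [i|]; first exact/ltW/central_path_gt0.
exact: central_path_constr.
Qed.

(** Stationarity along [w - w_mu], combined with the exact second order
    expansion of the objective. *)
Lemma central_path_gap mu w : 0 < mu -> feasible D w ->
  quad (cpath mu) + weight mu * (\sum_i w.2 i ord0 / (cpath mu).2 i ord0) - mu
  <= quad w.
Proof.
move=> mu0 [w0 cw]; rewrite (quad_expansion _ _ _ (cpath mu) w).
rewrite stationary //; last first.
  by rewrite linearB /= cw central_path_constr // subrr.
under [X in _ <= _ + _ * X + _]eq_bigr do
  rewrite !mxE mulrBl divff ?gt_eqF ?central_path_gt0 //.
rewrite sumrB sumr_const card_ord mulrBr addrA weightK //.
by rewrite lerDl mulr_ge0 ?invr_ge0 ?ler0n ?dotv_ge0.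
Qed.

Lemma central_path_le mu w : 0 < mu -> feasible D w ->
  quad (cpath mu) <= quad w + mu.
Proof.
move=> mu0 fw; have := central_path_gap mu0 fw.
suff : 0 <= weight mu * (\sum_i w.2 i ord0 / (cpath mu).2 i ord0) by lra.
rewrite mulr_ge0 ?(ltW (weight_gt0 p_gt0 mu0)) // sumr_ge0 // => i _.
by rewrite divr_ge0 ?(ltW (central_path_gt0 _ mu0)) //; exact: fw.1.
Qed.

Lemma central_path_lower mu w i : 0 < mu -> solution w ->
  w.2 i ord0 <= (p + p)%:R * (cpath mu).2 i ord0.
Proof.
move=> mu0 /primal_solutionsP[fw wmin]; have := central_path_gap mu0 fw.
have := wmin _ (central_path_feasible mu0) => h1 h2.
have k0 := weight_gt0 p_gt0 mu0.
rewrite -ler_pdivrMr ?central_path_gt0 // -(ler_pM2l k0) weightK //.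
apply: (@le_trans _ _ (weight mu * (\sum_i w.2 i ord0 / (cpath mu).2 i ord0)));
  last by lra.
rewrite ler_pM2l // [leRHS](bigD1 i) //= lerDl sumr_ge0 // => j _.
by rewrite divr_ge0 ?(ltW (central_path_gt0 _ mu0)) //; exact: fw.1.
Qed.

(** The objective is flat between two solutions, so along this direction the
    barrier alone must be stationary. *)
Lemma central_path_optimal_face mu w w' : 0 < mu -> solution w -> solution w' ->
  \sum_i (w'.2 i ord0 - w.2 i ord0) / (cpath mu).2 i ord0 = 0.
Proof.
move=> mu0 sw sw'; have k0 := weight_gt0 p_gt0 mu0.
have /primal_solutionsP[[_ cw] _] := sw.
have /primal_solutionsP[[_ cw'] _] := sw'.
have := quad_slope_solution (cpath mu) sw sw'.
rewrite stationary //; last by rewrite linearB /= cw cw' subrr.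
move=> /eqP; rewrite mulf_eq0 gt_eqF //= => /eqP s0; apply: etrans s0.
by apply: eq_bigr => i _; rewrite !mxE.
Qed.

Lemma notin_Ibar w i : solution w -> i \notin I -> w.2 i ord0 = 0.
Proof.
move=> sw; rewrite inE => /asboolPn nI; apply/eqP.
have /primal_solutionsP[[w0 _] _] := sw.
by rewrite eq_le w0 andbT leNgt; apply/negP => wi; apply: nI; exists w.
Qed.

Definition central_filter : set_system ('cV[R]_n * 'cV[R]_(p + p)) :=
  cpath mu @[mu --> 0^'+].

#[global] Instance central_filter_proper : ProperFilter central_filter.
Proof. exact: fmap_proper_filter. Qed.

Lemma central_filterE (A : set ('cV[R]_n * 'cV[R]_(p + p))) (e : R) : 0 < e ->
  (forall mu, 0 < mu -> mu < e -> A (cpath mu)) -> central_filter A.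
Proof.
move=> e0 Ap; rewrite /central_filter /fmap /=; near=> mu; apply: Ap.
  by near: mu; exact: nbhs_right_gt.
by near: mu; exact: nbhs_right_lt.
Unshelve. all: by end_near. Qed.

Lemma central_path_bounded : exists M : R, central_filter (@box R n (p + p) M).
Proof.
have [M MP] := coercive y ker_inj (1 + 2^-1 * dotv y y) lambda_gt0.
exists M; apply: (central_filterE ltr01) => mu mu0 mu1.
apply: MP; first exact: central_path_feasible.
have f0 : feasible D 0 by split; [move=> i; rewrite mxE | rewrite linear0].
have := central_path_le mu0 f0; rewrite !quad_residual /=.
have s0 : \sum_i (0 : 'cV[R]_(p + p)) i ord0 = 0.
  by rewrite big1 // => i _; rewrite mxE.
by rewrite mulmx0 subr0 s0; lra.
Qed.

Lemma cluster_solution w : cluster central_filter w -> solution w.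
Proof.
move=> cw; apply/primal_solutionsP; split.
  apply: closed_feasible; move: cw; rewrite clusterE; apply.
  by apply: (central_filterE ltr01) => mu mu0 _; exact: central_path_feasible.
move=> w' fw'; apply/ler_addgt0Pr => e e0.
apply: (cluster_le cw); first exact: quad_continuous.
apply: (central_filterE e0) => mu mu0 mue /=.
by apply: le_trans (central_path_le mu0 fw') _; rewrite lerD2l ltW.
Qed.

(** The bound [central_path_lower] is uniform in [mu], so it passes to the
    limit. *)
Lemma cluster_gt0 w i : cluster central_filter w -> i \in I -> 0 < w.2 i ord0.
Proof.
move=> cw; rewrite inE => /asboolP[w' [sw' w'i]].
suff : w'.2 i ord0 - (p + p)%:R * w.2 i ord0 <= 0.
  rewrite subr_le0 => /(lt_le_trans w'i); rewrite pmulr_rgt0 // ltr0n.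
  by rewrite addn_gt0 p_gt0.
apply: (@cluster_le _ _ _ (fun v : 'cV[R]_n * 'cV[R]_(p + p) =>
  w'.2 i ord0 - (p + p)%:R * v.2 i ord0) w _ cw).
  apply: cvgB; first exact: cvg_cst.
  by apply: cvgM; [exact: cvg_cst | exact: snd_coord_continuous].
apply: (central_filterE ltr01) => mu mu0 _ /=.
by rewrite subr_le0 central_path_lower.
Qed.

(** The limit of [central_path_optimal_face] between [w] and [w']: off [Ibar]
    the terms vanish, and on [Ibar] the denominators stay away from 0. *)
Lemma cluster_ratio_sum w w' : cluster central_filter w -> solution w' ->
  \sum_(i in I) w'.2 i ord0 / w.2 i ord0 = #|I|%:R.
Proof.
move=> cw sw'; have sw := cluster_solution cw.
pose g (a b : 'cV[R]_n * 'cV[R]_(p + p)) (v : 'cV[R]_n * 'cV[R]_(p + p)) :=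
  \sum_(i in I) (b.2 i ord0 - a.2 i ord0) / v.2 i ord0.
have gle a b : solution a -> solution b -> g a b w <= 0.
  move=> sa sb; apply: (@cluster_le _ _ _ (g a b) w _ cw).
    apply: sum_continuous => i iI; apply: cvgM; first exact: cvg_cst.
    apply: cvgV; last exact: snd_coord_continuous.
    by rewrite gt_eqF // cluster_gt0.
  apply: (central_filterE ltr01) => mu mu0 _ /=.
  rewrite -(central_path_optimal_face mu0 sa sb) [leRHS](bigID (mem I)) /=.
  rewrite [X in _ <= _ + X]big1 ?addr0 // => i iI.
  by rewrite (notin_Ibar sa iI) (notin_Ibar sb iI) subrr mul0r.
have g0 : g w w' w = 0.
  apply/le_anti; rewrite gle //= -oppr_le0.
  rewrite (_ : - g w w' w = g w' w w) ?gle // /g -sumrN.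
  by apply: eq_bigr => i _; rewrite -mulNr opprB.
apply: subr0_eq; apply: etrans g0; rewrite -sumr_const -sumrB.
apply: eq_bigr => i iI; rewrite mulrBl [w.2 i ord0 / _]divff //.
by rewrite gt_eqF ?cluster_gt0.
Qed.

(** [z] determines [D^T x] through the constraint, and [Phi x] is the same for
    all solutions; the kernel condition then determines [x]. *)
Lemma solution_inj w w' : solution w -> solution w' -> w.2 = w'.2 -> w = w'.
Proof.
move=> sw sw' z_eq; have /primal_solutionsP[[_ cw] _] := sw.
have /primal_solutionsP[[_ cw'] _] := sw'.
case: w w' sw sw' z_eq cw cw' => [x z] [x' z'] sw sw' /= <-; rewrite /constr /=.
move=> cw cw'; congr (_, _); apply/eqP; rewrite -subr_eq0; apply/eqP.
apply: ker_inj; last exact: (solution_Phi sw' sw).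
apply: (addIr (Itilde *m z)); rewrite add0r mulmxBr.
by move/eqP: cw'; rewrite addr_eq0 => /eqP ->; rewrite opprK cw add0r.
Qed.

(** The second part is the uniqueness of the maximizer: a solution is determined
    by its [z], which vanishes off [Ibar]. *)
Lemma cluster_center w w' : cluster central_filter w -> solution w' ->
  (geomean I w'.2 <= geomean I w.2)%E /\
  ((geomean I w.2 <= geomean I w'.2)%E -> w' = w).
Proof.
move=> cw sw'; have sw := cluster_solution cw.
have /primal_solutionsP[[w'0 _] _] := sw'.
have [le eq] := geomean_ratio_sum w'0 (fun i => @cluster_gt0 w i cw)
  (cluster_ratio_sum cw sw').
split=> // /eq zI; apply: solution_inj => //; apply/colP => i.
have [/zI //|iI] := boolP (i \in I).
by rewrite !notin_Ibar.
Qed.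

End Cluster.

(** * Dual points on the central path, and complementarity *)

Section Duality.
Context {R : realType} {n p q : nat}.
Variables (Phi : 'M[R]_(q, n)) (y : 'cV[R]_q) (D : 'M[R]_(n, p)) (lambda : R).
Hypothesis p_gt0 : (0 < p)%N.
Hypothesis lambda_gt0 : 0 < lambda.
Hypothesis ker_inj :
  forall x : 'cV[R]_n, D^T *m x = 0 -> Phi *m x = 0 -> x = 0.
Implicit Types (mu : R) (w d : 'cV[R]_n * 'cV[R]_(p + p)).
Implicit Types (s z : 'cV[R]_(p + p)).
Implicit Types (x : 'cV[R]_n) (u : 'cV[R]_p).

Local Notation quad := (quad_value Phi y lambda).
Local Notation solution := (primal_solutions Phi y D lambda).
Local Notation cpath := (central_path Phi y D lambda).
Local Notation weight := (@barrier_weight R p).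
Local Notation stationary :=
  (central_path_stationary y p_gt0 lambda_gt0 ker_inj).

(** The difference of the two objectives splits into a quadratic term and the
    complementarity term, both nonnegative when [s] and [z] are; this is weak
    duality together with its equality case. *)
Lemma duality_gap w x s u : constr D w = 0 ->
  D *m u + cvec Phi y - Qmx Phi *m x = 0 ->
  s = lambda *: evec (R := R) - (Itilde)^T *m u ->
  quad w = - (2^-1 * dotv (Qmx Phi *m x) x)
    + 2^-1 * dotv (Phi *m (w.1 - x)) (Phi *m (w.1 - x)) + dotv s w.2.
Proof.
move=> cw Du ->.
have {}Du : D *m u = Qmx Phi *m x - cvec Phi y.
  by apply/eqP; rewrite -subr_eq0 opprB addrA Du.
have uz : dotv (Itilde^T *m u) w.2 = - dotv (Qmx Phi *m x - cvec Phi y) w.1.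
  rewrite dotv_mulmx trmxK -Du dotv_mulmx -dotvNr; congr dotv.
  by move/eqP: cw; rewrite /constr addrC addr_eq0 => /eqP.
rewrite /quad_value /quad_objective dotvDl dotvNl uz dotvZl dotvDl dotvNl.
rewrite !dotv_Qmx.
rewrite !mulmxDr mulmxN !(dotvDl, dotvDr, dotvNl, dotvNr).
by rewrite (dotvC (Phi *m w.1) (Phi *m x)); field.
Qed.

(** The derivative of the barrier, which plays the role of the dual variable
    [s]. *)
Definition central_slack mu : 'cV[R]_(p + p) :=
  \col_i (weight mu / (cpath mu).2 i ord0).

(** The [u] forced on the second half of the coordinates by
    [s = lambda *: e - Itilde^T *m u]. *)
Definition central_dual mu : 'cV[R]_p :=
  \col_i (central_slack mu (rshift p i) ord0 - lambda).

Lemma Itilde_tr_mul u (i : 'I_p) :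
  (Itilde^T *m u) (lshift p i) ord0 = u i ord0 /\
  (Itilde^T *m u) (rshift p i) ord0 = - u i ord0.
Proof.
rewrite /Itilde tr_row_mx mul_col_mx trmx1 linearN /= trmx1 mulNmx mul1mx.
by rewrite col_mxEu col_mxEd mxE.
Qed.

(** Stationarity along the direction that raises two paired coordinates
    together. *)
Lemma central_slack_pair mu i : 0 < mu ->
  central_slack mu (lshift p i) ord0 + central_slack mu (rshift p i) ord0
    = 2 * lambda.
Proof.
move=> mu0; rewrite -(slope_paired_coord Phi y lambda (cpath mu) i).
rewrite stationary ?constr_paired_coord // /paired_coord /=.
have sum1 (a : 'I_(p + p)) (F : 'I_(p + p) -> R) :
    \sum_j (j == a)%:R / F j = (F a)^-1.
  rewrite (bigD1 a) //= eqxx mul1r big1 ?addr0 // => j /negPf ->.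
  by rewrite mul0r.
under eq_bigr do rewrite !mxE eqxx !andbT mulrDl.
by rewrite big_split /= !sum1 !mxE mulrDr.
Qed.

Lemma central_slackE mu : 0 < mu ->
  central_slack mu = lambda *: evec (R := R) - (Itilde)^T *m central_dual mu.
Proof.
move=> mu0; apply/colP => k; rewrite [RHS]mxE [X in _ = X + _]mxE.
rewrite [X in _ = _ * X + _]mxE [X in _ = _ + X]mxE mulr1.
have [i ->|i ->] := split_ordP k.
  rewrite (Itilde_tr_mul _ i).1 [X in _ = _ - X]mxE.
  by have := central_slack_pair i mu0; lra.
by rewrite (Itilde_tr_mul _ i).2 [X in _ = _ - - X]mxE; lra.
Qed.

Lemma central_dual_feasible mu : 0 < mu ->
  D *m central_dual mu + cvec Phi y - Qmx Phi *m (cpath mu).1 = 0.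
Proof.
move=> mu0; set u := central_dual mu.
set g := Qmx Phi *m (cpath mu).1 - cvec Phi y.
suff dual dx : dotv g dx = dotv (D *m u) dx.
  have -> : D *m u + cvec Phi y - Qmx Phi *m (cpath mu).1 = D *m u - g.
    by rewrite /g opprB addrA.
  by apply: dotv_le0; rewrite dotvDl dotvNl dual subrr.
(* An arbitrary move of [x], compensated in the first half of [z] alone. *)
pose t := D^T *m dx.
have cd : constr D (dx, col_mx (- t) 0) = 0.
  apply/colP => i; rewrite /constr mxE Itilde_mul /= col_mxEu col_mxEd.
  by rewrite [X in _ + (X - _)]mxE [X in _ + (_ - X)]mxE subr0 subrr mxE.
have := stationary mu0 cd.
rewrite /quad_slope /= -/g dotv_evec !big_split_ord /=.
rewrite [X in _ * (_ + X)]big1 => [|i _]; last by rewrite col_mxEd mxE.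
rewrite [X in _ = _ * (_ + X)]big1 => [|i _]; last first.
  by rewrite col_mxEd mxE mul0r.
rewrite !addr0 => /(canRL (addrK _)) ->.
rewrite dotv_mulmx -/t !mulr_sumr -sumrB; apply: eq_bigr => i _.
rewrite col_mxEu [(- t) i ord0]mxE [u i ord0]mxE.
have /(canRL (addKr _)) -> := central_slack_pair i mu0.
by rewrite [central_slack _ _ _]mxE; ring.
Qed.

Lemma central_dual_gap mu : 0 < mu ->
  - (2^-1 * dotv (Qmx Phi *m (cpath mu).1) (cpath mu).1) = quad (cpath mu) - mu.
Proof.
move=> mu0; have cp := central_path_constr y p_gt0 lambda_gt0 ker_inj mu0.
rewrite (duality_gap cp (central_dual_feasible mu0) (central_slackE mu0)).
rewrite subrr mulmx0 dotv0 mulr0 addr0.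
suff -> : dotv (central_slack mu) (cpath mu).2 = mu by rewrite addrK.
have z0 i := central_path_gt0 y p_gt0 lambda_gt0 ker_inj i mu0.
rewrite /dotv (eq_bigr (fun=> weight mu)) => [|i _]; last first.
  by rewrite mxE divfK // gt_eqF.
by rewrite sumr_const card_ord -mulr_natr weightK.
Qed.

(** The dual points on the central path have gap [mu], so the dual optimal value
    is at least the primal one; [duality_gap] then forces every product
    [s_i * z_i] to vanish. *)
Lemma dual_solution_complementary w v i : solution w ->
  dual_solutions Phi y D lambda v -> 0 < v.1.2 i ord0 -> w.2 i ord0 = 0.
Proof.
case: v => [[x s] u] sw [/= s0 vmax] si.
have /primal_solutionsP[[w0 cw] wmin] := sw.
have vge mu : 0 < mu ->
    ((quad w - mu)%:E <= dual_objective Phi y D lambda (x, s, u))%E.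
  move=> mu0.
  have slack0 : nneg_vec (central_slack mu).
    move=> j; rewrite mxE divr_ge0 //; first exact/ltW/weight_gt0.
    exact/ltW/(central_path_gt0 y p_gt0 lambda_gt0 ker_inj).
  have := vmax ((cpath mu).1, central_slack mu, central_dual mu) slack0.
  rewrite {1}/dual_objective central_dual_feasible // eqxx.
  rewrite (introT eqP (central_slackE mu0)) central_dual_gap //.
  apply: le_trans.
  by rewrite lee_fin lerD2r wmin //; exact: central_path_feasible.
move: vge; rewrite /dual_objective.
case: ifPn => [/andP[/eqP Du /eqP es] vge|_ vge]; last first.
  by have := vge 1 ltr01.
have {}vge : quad w <= - (2^-1 * dotv (Qmx Phi *m x) x).
  apply/ler_addgt0Pr => e e0; have := vge e e0; rewrite lee_fin; lra.
move: vge; rewrite (duality_gap cw Du es).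
have := dotv_ge0 (Phi *m (w.1 - x)) => N0 le0.
have sz0 : dotv s w.2 <= 0 by lra.
have : s i ord0 * w.2 i ord0 <= 0.
  apply: le_trans sz0; rewrite /dotv (bigD1 i) //= lerDl.
  by apply: sumr_ge0 => j _; rewrite mulr_ge0.
by rewrite pmulr_rle0 // => wi; apply/le_anti; rewrite wi w0.
Qed.

Lemma analytic_center_domainE w0 : solution w0 ->
  analytic_center_domain Phi y D lambda = primal_solutions Phi y D lambda.
Proof.
move=> sw0; have /primal_solutionsP[_ w0min] := sw0.
apply/seteqP; split=> w; rewrite /analytic_center_domain /=
  (optimal_valueP sw0).
  move=> [z0 [qw] cw _]; apply/primal_solutionsP; split; first by split.
  by move=> w' fw'; rewrite /quad_value qw; exact: w0min.
move=> sw; have /primal_solutionsP[[z0 cw] _] := sw; split=> //.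
  by rewrite (solution_quad sw0 sw).
move=> i; rewrite inE => /asboolP[v [sv vi]].
exact: dual_solution_complementary sw sv vi.
Qed.

(** A cluster point maximizes the geometric mean over the primal solutions and
    any other maximizer equals it, so it is the point selected by [get]. *)
Lemma cluster_analytic_center w : cluster (central_filter Phi y D lambda) w ->
  analytic_center Phi y D lambda = w.
Proof.
move=> cw; have sw := cluster_solution p_gt0 lambda_gt0 ker_inj cw.
have center w' : solution w' -> _ := cluster_center p_gt0 lambda_gt0 ker_inj cw.
rewrite /analytic_center (analytic_center_domainE sw).
case: xgetP => [v _ [sv vmax]|noarg].
  by apply: (center v sv).2; exact: vmax.
by exfalso; apply: (noarg w); split=> // w' sw'; exact: (center w' sw').1.
Qed.

Lemma central_path_cvg :
  central_filter Phi y D lambda --> analytic_center Phi y D lambda.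
Proof.
have [M pM] := central_path_bounded y p_gt0 lambda_gt0 ker_inj.
apply: (cvg_compact_cluster (@compact_box R _ _ M) pM) => w _ cw.
by rewrite (cluster_analytic_center cw).
Qed.

End Duality.

(** * The analytic center lies in the relative interior *)

Section RelativeInterior.
Context {R : realType} {n p q : nat}.
Variables (Phi : 'M[R]_(q, n)) (y : 'cV[R]_q) (D : 'M[R]_(n, p)) (lambda : R).
Hypothesis p_gt0 : (0 < p)%N.
Hypothesis lambda_gt0 : 0 < lambda.
Hypothesis ker_inj :
  forall x : 'cV[R]_n, D^T *m x = 0 -> Phi *m x = 0 -> x = 0.

Local Notation slope := (quad_slope Phi y lambda).
Local Notation solution := (primal_solutions Phi y D lambda).
Local Notation I := (Ibar Phi y D lambda).

Lemma analytic_center_cluster :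
  cluster (central_filter Phi y D lambda) (analytic_center Phi y D lambda).
Proof.
have [M pM] := central_path_bounded y p_gt0 lambda_gt0 ker_inj.
have [w [_ cw]] :=
  @compact_box R _ _ M _ (central_filter_proper Phi y D lambda) pM.
by rewrite (cluster_analytic_center p_gt0 lambda_gt0 ker_inj cw).
Qed.

(** [Ibar] contains at most one index of each pair, and near the center the sign
    of [(D^T x)_i] is the one that makes the coordinate of [z] with index in
    [Ibar] positive, the other one being 0. *)
Lemma analytic_center_relint :
  relint (lasso_solutions Phi y D lambda) (analytic_center Phi y D lambda).1.
Proof.
have cc := analytic_center_cluster; set c := analytic_center _ _ _ _ in cc *.
have sc := cluster_solution p_gt0 lambda_gt0 ker_inj cc.
have c0 i : i \in I -> 0 < c.2 i ord0 :=
  cluster_gt0 p_gt0 lambda_gt0 ker_inj cc.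
have /primal_solutionsP[[_ cc0] cmin] := sc.
split; first exact: solution_lasso sc.
have lr i : rshift p i \in I -> lshift p i \notin I.
  move=> ri; apply/negP => li; have := c0 _ ri.
  by rewrite (solution_complementary lambda_gt0 sc (c0 _ li)) ltxx.
have DTc (i : 'I_p) : {for c.1, continuous (fun x => (D^T *m x) i ord0)}.
  rewrite (_ : (fun x => _) = fun x : 'cV[R]_n => \sum_j D^T i j * x j ord0).
    apply: sum_continuous => j _.
    have := @cvgM R _ (nbhs c.1) _ (fun=> D^T i j)
      (fun x : 'cV[R]_n => x j ord0).
    by apply; [exact: cvg_cst | exact: coord_continuous].
  by apply/funext => x; rewrite mxE.
have sgn : \forall x \near c.1, forall i : 'I_p,
    (lshift p i \in I -> (D^T *m x) i ord0 < 0) /\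
    (rshift p i \in I -> 0 < (D^T *m x) i ord0).
  apply: (@filter_forall _ _ (fun (i : 'I_p) (x : 'cV[R]_n) =>
    (lshift p i \in I -> (D^T *m x) i ord0 < 0) /\
    (rshift p i \in I -> 0 < (D^T *m x) i ord0)) (nbhs c.1) _) => i.
  have ci := constr_coord i cc0.
  have [li|li] := boolP (lshift p i \in I).
    have ri : (rshift p i \in I) = false by apply/negbTE/(contraL (@lr i)).
    have ci0 : (D^T *m c.1) i ord0 < 0.
      by rewrite ci (notin_Ibar sc (negbT ri)) sub0r oppr_lt0 c0.
    have nx : nbhs c.1 ((fun x => (D^T *m x) i ord0) @^-1` [set r | r < 0]).
      by apply: (DTc i); apply: open_nbhs_nbhs; split=> //; exact: open_lt.
    by apply: filterS nx => x xi; rewrite ri.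
  have [ri|ri] := boolP (rshift p i \in I); last exact: nearW.
  have ci0 : 0 < (D^T *m c.1) i ord0.
    by rewrite ci (notin_Ibar sc li) subr0 c0.
  have nx : nbhs c.1 ((fun x => (D^T *m x) i ord0) @^-1` [set r | 0 < r]).
    by apply: (DTc i); apply: open_nbhs_nbhs; split=> //; exact: open_gt.
  by apply: filterS nx => x xi.
apply: filterS sgn => x sgnx [k [a [v [vX a1 xE]]]].
pose V j := (v j, split_parts D (v j)).
have sV j : solution (V j) by apply/lasso_solutionsP.
(* The displacement from the center; each [V j - c] is a direction of the linear
   span of the optimal face. *)
pose d := \sum_j a j *: (V j - c).
pose face e := [/\ slope c e = 0, Phi *m e.1 = 0, constr D e = 0 &
  forall i, i \notin I -> e.2 i ord0 = 0].
have [dslope dPhi dconstr dI] : face d.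
  apply: (big_ind face).
  - split=> [|||i _]; rewrite ?mulmx0 ?linear0 ?mxE //.
    by rewrite /quad_slope !dotv0 mulr0 addr0.
  - move=> e1 e2 [s1 P1 c1 i1] [s2 P2 c2 i2]; split.
    + by rewrite -[e1]scale1r quad_slope_lin s1 s2 mulr0 addr0.
    + by rewrite /= mulmxDr P1 P2 addr0.
    + by rewrite linearD /= c1 c2 addr0.
    + by move=> i iI; rewrite mxE i1 ?i2 ?addr0.
  - move=> j _; have /primal_solutionsP[[_ cV] _] := sV j; split.
    + rewrite -[_ *: _]addr0 quad_slope_lin (quad_slope_solution c sc (sV j)).
      by rewrite mulr0 add0r /quad_slope !dotv0 mulr0 addr0.
    + by rewrite /= -scalemxAr (solution_Phi sc (sV j)) scaler0.
    + by rewrite linearZ linearB /= cV cc0 subrr scaler0.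
    + move=> i iI; rewrite -[_.2]/(a j *: ((V j).2 - c.2)).
      rewrite mxE [X in _ * X]mxE [X in _ + X]mxE.
      rewrite (notin_Ibar sc iI) (notin_Ibar (sV j) iI).
      by rewrite subrr mulr0.
have x_eq : (c + d).1 = x.
  rewrite /= /d (raddf_sum fst) /=.
  under eq_bigr do rewrite scalerBr.
  by rewrite sumrB -scaler_suml a1 scale1r -xE addrC subrK.
rewrite -x_eq; apply: (@solution_lasso _ _ _ _ Phi y D lambda lambda_gt0).
have cw : constr D (c + d) = 0 by rewrite linearD /= cc0 dconstr addr0.
have wI i : i \notin I -> (c + d).2 i ord0 = 0.
  by move=> iI; rewrite mxE dI // addr0; exact: notin_Ibar sc iI.
apply/primal_solutionsP; split; last first.
  move=> w' fw'; have := quad_along Phi y lambda c d 1.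
  rewrite scale1r dslope dPhi dotv0 !mulr0 !addr0 => ->; exact: cmin.
split=> // i; have [iI|iI] := boolP (i \in I); last by rewrite wI.
have := x_eq; have [j ij|j ij] := split_ordP i; rewrite ij in iI * => xE'.
  have := constr_coord j cw; rewrite xE' (wI (rshift p j)) ?sub0r => [wj|].
    by have := (sgnx j).1 iI; rewrite wj oppr_lt0 => /ltW.
  exact: contraL (@lr j) iI.
have := constr_coord j cw; rewrite xE' (wI (lshift p j)) ?subr0 => [wj|].
  by have := (sgnx j).2 iI; rewrite wj => /ltW.
exact: lr.
Qed.

End RelativeInterior.

Theorem corollary5p7 (R : realType) (n p q : nat)
    (n_gt0 : (0 < n)%N) (p_gt0 : (0 < p)%N) (q_gt0 : (0 < q)%N)
    (Phi : 'M[R]_(q, n)) (y : 'cV[R]_q) (D : 'M[R]_(n, p)) (lambda : R)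
    (lambda_gt0 : 0 < lambda)
    (ker_cap : [set x : 'cV[R]_n | D^T *m x = 0] `&`
               [set x : 'cV[R]_n | Phi *m x = 0] = [set 0]) :
  (central_path Phi y D lambda mu).1 @[mu --> 0^'+] -->
    (analytic_center Phi y D lambda).1
  /\ relint (lasso_solutions Phi y D lambda) (analytic_center Phi y D lambda).1.
Proof.
have ker_inj (x : 'cV[R]_n) : D^T *m x = 0 -> Phi *m x = 0 -> x = 0.
  by move=> Dx Px; have : [set 0 : 'cV[R]_n] x by rewrite -ker_cap.
split; last exact: analytic_center_relint.
have fst_cvg : fst v @[v --> analytic_center Phi y D lambda] -->
    (analytic_center Phi y D lambda).1 by exact: cvg_fst.
have path_cvg := @central_path_cvg _ _ _ _ Phi y D _ p_gt0 lambda_gt0 ker_inj.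
exact: cvg_comp path_cvg fst_cvg.
Qed.
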